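(* Let $p\in\mathbb{R}$ with $\frac12<p<1$, and let $E:=L^p(\mathbb{C},\mu)$ be the complex topological vector space of equivalence classes of complex-valued $L^p$-functions on $\mathbb{C}$, where $\mu$ is the Gauss measure on $\mathbb{C}=\mathbb{R}^2$. Let $f\colon\mathbb{C}\to E$, $f(z):=\mathbf{1}_{A(z)}$, where $A(z):=\{w\in\mathbb{C}: \operatorname{Re}(w)\le\operatorname{Re}(z)\}$. Then $f$ is of class $C^1_{\mathbb{C}}$ and $f'$ vanishes identically, but $f$ is not of class $C^2_{\mathbb{C}}$.
   Context: Gauss measure: $d\nu(x)=\frac{1}{\sqrt{\pi}}e^{-x^2}\,dx$ on $\mathbb{R}$ and $\mu:=\nu\otimes\nu$ on $\mathbb{C}=\mathbb{R}^2$. $L^p(\mathbb{C},\mu)$ for $0<p<1$ consists of the classes (modulo $\mu$-a.e. equality) of measurable $\gamma\colon\mathbb{C}\to\mathbb{C}$ with $\int_{\mathbb{C}}|\gamma|^p\,d\mu<\infty$, with its usual vector topology, given by the metric $(\gamma,\eta)\mapsto\int_{\mathbb{C}}|\gamma-\eta|^p\,d\mu$. For measurable $A\subseteq\mathbb{C}$, $\mathbf{1}_A$ denotes (the class of) the characteristic function of $A$. Differentiability classes: let $\mathbb{K}$ be a non-discrete topological field (here $\mathbb{K}=\mathbb{C}$), $U\subseteq\mathbb{K}$ open, $E$ a Hausdorff topological $\mathbb{K}$-vector space and $f\colon U\to E$ a map. $f$ is of class $C^0_{\mathbb{K}}$ if it is continuous; then $f^{<0>}:=f$. Recursively, for $k\in\mathbb{N}$,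 $f$ is of class $C^k_{\mathbb{K}}$ if it is of class $C^{k-1}_{\mathbb{K}}$ and there is a continuous map $f^{<k>}\colon U^{k+1}\to E$ such that $$f^{<k>}(x_1,\ldots,x_{k+1})=\frac{1}{x_1-x_2}\left(f^{<k-1>}(x_1,x_3,\ldots,x_{k+1})-f^{<k-1>}(x_2,x_3,\ldots,x_{k+1})\right)$$ for all $(x_1,\ldots,x_{k+1})\in U^{k+1}$ with $x_1\ne x_2$ (such $f^{<k>}$ is unique). The derivative of a $C^1_{\mathbb{K}}$-map is $f'(x)=f^{<1>}(x,x)$. *)

(* Defs.v *)
From HB Require Import structures.
From mathcomp Require Import all_boot all_order all_algebra.
From mathcomp Require Import complex.
From mathcomp Require Import all_classical all_reals all_analysis.
From mathcomp Require Import measurable_realfun.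

Import Order.TTheory GRing.Theory Num.Theory.
Import numFieldNormedType.Exports.

Local Open Scope classical_set_scope.
Local Open Scope complex_scope.
Local Open Scope ring_scope.

Section DifferentiabilityClasses.
Context {K : numFieldType} {E : topologicalLmodType K}.

Definition pow_set (U : set K) (n : nat) : set 'rV[K^o]_n :=
  [set x | forall i, U (x ord0 i)].

(* [divided_difference U f k g] says that g = f^{<k>} on U^{k+1}. Vectors are
   indexed from 0, and [col' i x] is x with its coordinate of index i removed.
   Only the values of f on U, and of g on U^{k+1}, matter. *)
Fixpoint divided_difference (U : set K) (f : K -> E) (k : nat) :
    set ('rV[K^o]_k.+1 -> E) :=
  match k return set ('rV[K^o]_k.+1 -> E) with
  | 0 => [set g |
      {within pow_set U 1, continuous g} /\
      forall x, pow_set U 1 x -> g x = f (x ord0 ord0)]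
  | k'.+1 => [set g |
      {within pow_set U k'.+2, continuous g} /\
      exists2 h, divided_difference U f k' h &
        forall x, pow_set U k'.+2 x -> x ord0 0 != x ord0 1 ->
          g x = (x ord0 0 - x ord0 1)^-1 *: (h (col' 1 x) - h (col' 0 x))]
  end.

Definition of_class (k : nat) (U : set K) (f : K -> E) : Prop :=
  divided_difference U f k !=set0.

(* The value f^{<1>}(x, x). It is meaningful for f of class C^1 on U open, x in
   U and E Hausdorff, in which case f^{<1>} is unique on U^2. *)
Definition bgn_derivative (U : set K) (f : K -> E) (x : K) : E :=
  xget (fun=> 0) (divided_difference U f 1) (const_mx x).

End DifferentiabilityClasses.

Set Implicit Arguments.
Unset Strict Implicit.
Unset Printing Implicit Defensive.

(* The Borel sigma-algebra of C = R^2: that of R * R, transported along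
   (x, y) |-> x + iy. *)
Fact complex_display : measure_display.
Proof. exact: default_measure_display. Qed.

Section ComplexMeasurable.
Context {R : realType}.

Definition complex_of_pair (xy : R * R) : R[i] := xy.1 +i* xy.2.

Definition complex_measurable : set (set R[i]) :=
  [set A | measurable (complex_of_pair @^-1` A)].

Let complex_measurable0 : complex_measurable set0.
Proof. by rewrite /complex_measurable /= preimage_set0; exact: measurable0. Qed.

Let complex_measurableC A : complex_measurable A -> complex_measurable (~` A).
Proof.
move=> mA; rewrite /complex_measurable /= -preimage_setC; exact: measurableC.
Qed.

Let complex_measurable_bigcup (F : (set R[i])^nat) :
  (forall i, complex_measurable (F i)) -> complex_measurable (\bigcup_i F i).
Proof.
move=> mF; rewrite /complex_measurable /= preimage_bigcup.
by apply: bigcup_measurable => i _; exact: mF.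
Qed.

HB.instance Definition _ := isPointed.Build R[i] 0.
HB.instance Definition _ := @isMeasurable.Build complex_display R[i]
  complex_measurable complex_measurable0 complex_measurableC
  complex_measurable_bigcup.

Lemma measurable_complex_of_pair : measurable_fun setT complex_of_pair.
Proof. by move=> _ A mA; rewrite setTI. Qed.

Lemma measurable_Re : measurable_fun setT (@complex.Re R).
Proof.
move=> _ A mA; rewrite setTI /measurable /= /complex_measurable /=.
have := @measurable_fst _ _ R R measurableT A mA; rewrite setTI; exact.
Qed.

Lemma measurable_Im : measurable_fun setT (@complex.Im R).
Proof.
move=> _ A mA; rewrite setTI /measurable /= /complex_measurable /=.
have := @measurable_snd _ _ R R measurableT A mA; rewrite setTI; exact.
Qed.

Lemma measurable_fun_complexP d (T : measurableType d) (f : T -> R[i]) :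
  measurable_fun setT f <->
  measurable_fun setT (fun t => complex.Re (f t)) /\
  measurable_fun setT (fun t => complex.Im (f t)).
Proof.
split=> [mf|[mr mi]].
  by split; [exact: (measurableT_comp measurable_Re)
            |exact: (measurableT_comp measurable_Im)].
have -> : f = complex_of_pair \o (fun t => (complex.Re (f t), complex.Im (f t))).
  by apply/funext => t /=; rewrite /complex_of_pair /=; case: (f t).
apply: (measurableT_comp measurable_complex_of_pair).
exact: measurable_fun_pair.
Qed.

Lemma normcE_ReIm (z : R[i]) :
  Normc.normc z = Num.sqrt (complex.Re z ^+ 2 + complex.Im z ^+ 2).
Proof. by case: z. Qed.

Lemma normc_ge0 (z : R[i]) : 0 <= Normc.normc z.
Proof. by rewrite normcE_ReIm sqrtr_ge0. Qed.

Lemma measurable_normc : measurable_fun setT (@Normc.normc R).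
Proof.
have -> : @Normc.normc R = fun z => Num.sqrt (complex.Re z ^+ 2 + complex.Im z ^+ 2).
  by apply/funext => z; exact: normcE_ReIm.
apply: (measurableT_comp (continuous_measurable_fun (@sqrt_continuous R))).
by apply: measurable_funD; apply: measurable_funX;
  [exact: measurable_Re|exact: measurable_Im].
Qed.

Lemma measurable_fun_complexD d (T : measurableType d) (f g : T -> R[i]) :
  measurable_fun setT f -> measurable_fun setT g ->
  measurable_fun setT (fun t => f t + g t).
Proof.
move=> /measurable_fun_complexP[fr fi] /measurable_fun_complexP[gr gi].
apply/measurable_fun_complexP; split.
- rewrite (_ : (fun _ => _) =
    (fun t => complex.Re (f t)) \+ (fun t => complex.Re (g t))).
    exact: measurable_funD.
  by apply/funext => t /=; case: (f t) => ? ?; case: (g t).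
- rewrite (_ : (fun _ => _) =
    (fun t => complex.Im (f t)) \+ (fun t => complex.Im (g t))).
    exact: measurable_funD.
  by apply/funext => t /=; case: (f t) => ? ?; case: (g t).
Qed.

Lemma measurable_fun_complexZ d (T : measurableType d) (a : R[i])
    (f : T -> R[i]) :
  measurable_fun setT f -> measurable_fun setT (fun t => a * f t).
Proof.
case: a => a b /measurable_fun_complexP[fr fi].
apply/measurable_fun_complexP; split.
- rewrite (_ : (fun _ => _) = (fun t => a * complex.Re (f t)) \-
      (fun t => b * complex.Im (f t))).
    by apply: measurable_funB; apply: measurable_funM.
  by apply/funext => t /=; case: (f t).
- rewrite (_ : (fun _ => _) = (fun t => a * complex.Im (f t)) \+
      (fun t => b * complex.Re (f t))).
    by apply: measurable_funD; apply: measurable_funM.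
  by apply/funext => t /=; case: (f t).
Qed.

End ComplexMeasurable.

Section GaussMeasure.
Context {R : realType}.

Definition gauss1 (A : set (measurableTypeR R)) : \bar R :=
  (\int[lebesgue_measure]_(x in A) (expR (- x ^+ 2) / Num.sqrt pi)%:E)%E.

Lemma gauss1_normal : gauss1 = normal_prob 0 (Num.sqrt 2^-1).
Proof.
have s0 : Num.sqrt (2^-1 : R) != 0 by rewrite gt_eqF// sqrtr_gt0 invr_gt0.
apply/funext => A; rewrite /gauss1 /normal_prob; apply: eq_integral => x _.
rewrite normal_pdfE// /normal_peak /normal_fun subr0.
have -> : Num.sqrt (2^-1 : R) ^+ 2 *+ 2 = 1.
  by rewrite sqr_sqrtr ?invr_ge0// -mulr_natr mulVf.
have -> : Num.sqrt (2^-1 : R) ^+ 2 * pi *+ 2 = pi.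
  by rewrite sqr_sqrtr ?invr_ge0// -mulr_natr mulrAC mulVf// mul1r.
by rewrite divr1 mulrC.
Qed.

Let gauss1_0 : gauss1 set0 = 0%E.
Proof. by rewrite gauss1_normal measure0. Qed.

Let gauss1_ge0 A : (0 <= gauss1 A)%E.
Proof. by rewrite gauss1_normal measure_ge0. Qed.

Let gauss1_sigma_additive : semi_sigma_additive gauss1.
Proof. by rewrite gauss1_normal; exact: measure_semi_sigma_additive. Qed.

HB.instance Definition _ := isMeasure.Build _ _ _ gauss1
  gauss1_0 gauss1_ge0 gauss1_sigma_additive.

Let gauss1_setT : gauss1 setT = 1%E.
Proof. by rewrite gauss1_normal probability_setT. Qed.

HB.instance Definition _ :=
  @Measure_isProbability.Build _ _ R gauss1 gauss1_setT.

Definition gauss (A : set R[i]) : \bar R :=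
  pushforward (gauss1 \x gauss1)%E complex_of_pair A.

Let gauss0 : gauss set0 = 0%E.
Proof. by rewrite /gauss /pushforward preimage_set0 measure0. Qed.

Let gauss_ge0 A : (0 <= gauss A)%E.
Proof. by rewrite /gauss /pushforward; exact: measure_ge0. Qed.

Let gauss_sigma_additive : semi_sigma_additive gauss.
Proof.
move=> F mF tF mUF; rewrite /gauss /pushforward preimage_bigcup.
apply: measure_semi_sigma_additive.
- by move=> n; exact: mF.
- apply/trivIsetP => /= i j _ _ ij; rewrite -preimage_setI.
  by move/trivIsetP : tF => /(_ _ _ _ _ ij) ->//; rewrite preimage_set0.
- by rewrite -preimage_bigcup.
Qed.

HB.instance Definition _ := isMeasure.Build _ _ _ gauss
  gauss0 gauss_ge0 gauss_sigma_additive.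

Let gauss_setT : gauss setT = 1%E.
Proof.
rewrite /gauss /pushforward preimage_setT -setXTT product_measure1E//.
by rewrite [X in (X * _)%E]gauss1_setT [X in (_ * X)%E]gauss1_setT mule1.
Qed.

HB.instance Definition _ :=
  @Measure_isProbability.Build _ _ R gauss gauss_setT.

End GaussMeasure.

Section LpSpace.
Local Open Scope quotient_scope.
Context d (T : measurableType d) (R : realType).
Variable mu : {measure set T -> \bar R}.
Implicit Types (p : R) (f g : T -> R[i]).

Definition Lp_integral p f : \bar R :=
  (\int[mu]_t (Normc.normc (f t) `^ p)%:E)%E.

Definition in_Lp p f : Prop :=
  measurable_fun setT f /\ (Lp_integral p f < +oo)%E.

Record Lp_fun p := LpFun { Lp_val :> T -> R[i]; Lp_valP : in_Lp p Lp_val }.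

HB.instance Definition _ p := gen_eqMixin (Lp_fun p).
HB.instance Definition _ p := gen_choiceMixin (Lp_fun p).

Definition Lp_ae_eq p (f g : Lp_fun p) : bool :=
  `[< {ae mu, forall t, f t = g t} >].

Let ae_refl p : reflexive (@Lp_ae_eq p).
Proof. by move=> f; apply/asboolP/aeW. Qed.

Let ae_sym p : symmetric (@Lp_ae_eq p).
Proof.
by move=> f g; apply/idP/idP => /asboolP h; apply/asboolP;
  apply: filterS h => t ->.
Qed.

Let ae_trans p : transitive (@Lp_ae_eq p).
Proof.
move=> f g h /asboolP gf /asboolP fh; apply/asboolP.
by apply: filterS2 gf fh => t -> ->.
Qed.

Canonical Lp_ae_eq_equiv p :=
  EquivRel (@Lp_ae_eq p) (@ae_refl p) (@ae_sym p) (@ae_trans p).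

(* The bounds on p are part of the type because the metric given to it below is
   one only if (a + b)^p <= a^p + b^p. *)
Definition Lp p (_ : 0 < p < 1) : Type := {eq_quot (@Lp_ae_eq p)}.

Section LpOperations.
Context (p : R) (hp : 0 < p < 1).
Local Notation E := (Lp hp).

HB.instance Definition _ := Choice.on E.
HB.instance Definition _ := EqQuotient.on E.

Definition Lp_class f (fL : in_Lp p f) : E := \pi_E (LpFun fL).

Definition Lp_repr (x : E) : T -> R[i] := Lp_val (repr x).

Lemma Lp_reprP (x : E) : in_Lp p (Lp_repr x).
Proof. exact: Lp_valP. Qed.

Lemma Lp_class_repr (x : E) : Lp_class (Lp_reprP x) = x.
Proof.
rewrite /Lp_class -[RHS]reprK; congr (\pi_E _).
by rewrite /Lp_repr; move: (Lp_reprP x); rewrite /Lp_repr; case: (repr x) => f fL fL' /=;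
  congr LpFun; exact: Prop_irrelevance.
Qed.

Lemma Lp_class_eq f g (fL : in_Lp p f) (gL : in_Lp p g) :
  Lp_class fL = Lp_class gL <-> {ae mu, forall t, f t = g t}.
Proof.
split=> [|fg]; first by move=> /eqmodP /asboolP.
by apply/eqmodP/asboolP.
Qed.

Lemma Lp_repr_class f (fL : in_Lp p f) :
  {ae mu, forall t, Lp_repr (Lp_class fL) t = f t}.
Proof. by apply/(Lp_class_eq (Lp_reprP _) fL); rewrite Lp_class_repr. Qed.

Lemma Lp_eqP (x y : E) : x = y <-> {ae mu, forall t, Lp_repr x t = Lp_repr y t}.
Proof.
by rewrite -(Lp_class_eq (Lp_reprP x) (Lp_reprP y)) !Lp_class_repr.
Qed.

Let p0 : 0 < p. Proof. by case/andP: hp. Qed.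
Let p1 : p <= 1. Proof. by case/andP: hp => _ /ltW. Qed.

Lemma powR_subadditive (a b : R) : 0 <= a -> 0 <= b ->
  (a + b) `^ p <= a `^ p + b `^ p.
Proof.
move=> a0 b0; have [s0|s0] := eqVneq (a + b) 0.
  by rewrite s0 powR0 ?gt_eqF// addr_ge0// powR_ge0.
have sgt0 : 0 < a + b by rewrite lt_neqAle eq_sym s0 addr_ge0.
have key c : 0 <= c -> c <= a + b -> (a + b) `^ p * (c / (a + b)) <= c `^ p.
  move=> c0 cs.
  have {2}-> : c = (a + b) * (c / (a + b)) by rewrite mulrC divfK.
  have q0 : 0 <= c / (a + b) by rewrite divr_ge0// ltW.
  rewrite powRM// ?(ltW sgt0)// ler_wpM2l ?powR_ge0//.
  move: q0; rewrite le_eqVlt => /predU1P[<-|q0]; first exact: powR_ge0.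
  by apply: ger1_powR => //; rewrite q0 ler_pdivrMr// mul1r.
rewrite -[leLHS]mulr1 -[X in _ * X](divff s0) mulrDl mulrDr.
by rewrite lerD// key// ?lerDl// lerDr.
Qed.

Lemma measurable_Lp_integrand f : measurable_fun setT f ->
  measurable_fun setT (fun t => (Normc.normc (f t) `^ p)%:E).
Proof.
move=> mf; apply/measurable_EFinP.
apply: (measurableT_comp (measurable_powR p)).
exact: (measurableT_comp measurable_normc).
Qed.

Lemma Lp_integral_ge0 f : (0 <= Lp_integral p f)%E.
Proof. by apply: integral_ge0 => t _; rewrite lee_fin powR_ge0. Qed.

Lemma Lp_integral_fin f : in_Lp p f -> Lp_integral p f \is a fin_num.
Proof. by case=> _ ?; rewrite ge0_fin_numE// Lp_integral_ge0. Qed.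

Lemma Lp_integral_ae f g : measurable_fun setT f -> measurable_fun setT g ->
  {ae mu, forall t, f t = g t} -> Lp_integral p f = Lp_integral p g.
Proof.
move=> mf mg fg; apply: ge0_ae_eq_integral => //;
  try exact: measurable_Lp_integrand;
  try by (move=> t _; rewrite lee_fin powR_ge0).
by apply: filterS fg => t -> _.
Qed.

Lemma Lp_integralD f g : measurable_fun setT f -> measurable_fun setT g ->
  (Lp_integral p (fun t => f t + g t)%R
   <= Lp_integral p f + Lp_integral p g)%E.
Proof.
move=> mf mg; rewrite /Lp_integral -ge0_integralD//;
  try exact: measurable_Lp_integrand;
  try by (move=> t _; rewrite lee_fin powR_ge0).
apply: ge0_le_integral => //.
- by move=> t _; rewrite lee_fin powR_ge0.
- exact/measurable_Lp_integrand/measurable_fun_complexD.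
- by apply: emeasurable_funD; exact: measurable_Lp_integrand.
- move=> t _; rewrite -EFinD lee_fin.
  apply: le_trans (powR_subadditive (normc_ge0 _) (normc_ge0 _)).
  rewrite ge0_ler_powR ?nnegrE ?addr_ge0 ?normc_ge0 ?(ltW p0)//.
  exact: le_normcD.
Qed.

Lemma Lp_integralZ a f : measurable_fun setT f ->
  Lp_integral p (fun t => a * f t) =
  ((Normc.normc a `^ p)%:E * Lp_integral p f)%E.
Proof.
move=> mf; rewrite /Lp_integral -ge0_integralZl//;
  try exact: measurable_Lp_integrand;
  try by (move=> *; rewrite ?lee_fin powR_ge0).
by apply: eq_integral => t _; rewrite -EFinM Normc.normcM powRM ?normc_ge0.
Qed.

Lemma in_Lp0 : in_Lp p (fun=> 0).
Proof.
split; first exact: measurable_cst.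
rewrite /Lp_integral integral0_eq ?ltry// => t _.
by rewrite Normc.normc0 powR0// gt_eqF.
Qed.

Lemma in_LpD f g : in_Lp p f -> in_Lp p g -> in_Lp p (fun t => f t + g t).
Proof.
move=> [mf ff] [mg fg]; split; first exact: measurable_fun_complexD.
by rewrite (le_lt_trans (Lp_integralD mf mg))// lte_add_pinfty.
Qed.

Lemma in_LpZ a f : in_Lp p f -> in_Lp p (fun t => a * f t).
Proof.
move=> fL; have [mf ff] := fL; split; first exact: measurable_fun_complexZ.
by rewrite Lp_integralZ// lte_mul_pinfty ?lee_fin ?powR_ge0.
Qed.

Definition Lp_zero : E := Lp_class in_Lp0.
Definition Lp_add (x y : E) : E := Lp_class (in_LpD (Lp_reprP x) (Lp_reprP y)).
Definition Lp_scale (a : R[i]) (x : E) : E := Lp_class (in_LpZ a (Lp_reprP x)).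
Definition Lp_opp (x : E) : E := Lp_scale (-1) x.

Let addE (x y : E) :
  {ae mu, forall t, Lp_repr (Lp_add x y) t = Lp_repr x t + Lp_repr y t}.
Proof. exact: Lp_repr_class. Qed.

Let scaleE a (x : E) :
  {ae mu, forall t, Lp_repr (Lp_scale a x) t = a * Lp_repr x t}.
Proof. exact: Lp_repr_class. Qed.

Let zeroE : {ae mu, forall t, Lp_repr Lp_zero t = 0}.
Proof. exact: Lp_repr_class. Qed.

Let addA : associative Lp_add.
Proof.
move=> x y z; apply/Lp_eqP.
apply: (filter_app _ _ (addE x y)).
apply: (filter_app _ _ (addE (Lp_add x y) z)).
apply: (filter_app _ _ (addE y z)).
apply: (filter_app _ _ (addE x (Lp_add y z))).
apply: aeW.
by move=> t -> -> -> ->; rewrite addrA.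
Qed.

Let addC : commutative Lp_add.
Proof.
move=> x y; apply/Lp_eqP.
apply: (filter_app _ _ (addE y x)).
apply: (filter_app _ _ (addE x y)).
apply: aeW.
by move=> t -> ->; rewrite addrC.
Qed.

Let add0 : left_id Lp_zero Lp_add.
Proof.
move=> x; apply/Lp_eqP.
apply: (filter_app _ _ (zeroE)).
apply: (filter_app _ _ (addE Lp_zero x)).
apply: aeW.
by move=> t -> ->; rewrite add0r.
Qed.

Let addN : left_inverse Lp_zero Lp_opp Lp_add.
Proof.
move=> x; apply/Lp_eqP.
apply: (filter_app _ _ (zeroE)).
apply: (filter_app _ _ (scaleE (-1) x)).
apply: (filter_app _ _ (addE (Lp_opp x) x)).
apply: aeW.
by move=> t -> -> ->; rewrite mulN1r addNr.
Qed.

HB.instance Definition _ := GRing.isZmodule.Build E addA addC add0 addN.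

Let scaleA (a b : R[i]) (x : E) :
  Lp_scale a (Lp_scale b x) = Lp_scale (a * b) x.
Proof.
apply/Lp_eqP.
apply: (filter_app _ _ (scaleE (a * b) x)).
apply: (filter_app _ _ (scaleE b x)).
apply: (filter_app _ _ (scaleE a (Lp_scale b x))).
apply: aeW.
by move=> t -> -> ->; rewrite mulrA.
Qed.

Let scale1 : left_id 1 Lp_scale.
Proof.
move=> x; apply/Lp_eqP.
apply: (filter_app _ _ (scaleE 1 x)).
apply: aeW.
by move=> t ->; rewrite mul1r.
Qed.

Let scaleDr : right_distributive Lp_scale +%R.
Proof.
move=> a x y; apply/Lp_eqP.
apply: (filter_app _ _ (addE (Lp_scale a x) (Lp_scale a y))).
apply: (filter_app _ _ (scaleE a y)).
apply: (filter_app _ _ (scaleE a x)).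
apply: (filter_app _ _ (addE x y)).
apply: (filter_app _ _ (scaleE a (Lp_add x y))).
apply: aeW.
by move=> t -> -> ax ay ->; rewrite ax ay mulrDr.
Qed.

Let scaleDl (x : E) : {morph Lp_scale^~ x : a b / a + b}.
Proof.
move=> a b; apply/Lp_eqP.
apply: (filter_app _ _ (addE (Lp_scale a x) (Lp_scale b x))).
apply: (filter_app _ _ (scaleE b x)).
apply: (filter_app _ _ (scaleE a x)).
apply: (filter_app _ _ (scaleE (a + b) x)).
apply: aeW.
by move=> t -> ax bx ->; rewrite ax bx mulrDl.
Qed.

HB.instance Definition _ :=
  GRing.Zmodule_isLmodule.Build R[i] E scaleA scale1 scaleDr scaleDl.

Lemma Lp_reprB (x y : E) :
  {ae mu, forall t, Lp_repr (x - y) t = Lp_repr x t - Lp_repr y t}.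
Proof.
apply: (filter_app _ _ (scaleE (-1) y)).
apply: (filter_app _ _ (addE x (Lp_opp y))).
apply: aeW.
by move=> t -> ->; rewrite mulN1r.
Qed.

Lemma Lp_reprD (x y : E) :
  {ae mu, forall t, Lp_repr (x + y) t = Lp_repr x t + Lp_repr y t}.
Proof. exact: addE. Qed.

Lemma Lp_reprZ (a : R[i]) (x : E) :
  {ae mu, forall t, Lp_repr (a *: x) t = a * Lp_repr x t}.
Proof. exact: scaleE. Qed.

Lemma Lp_repr0 : {ae mu, forall t, Lp_repr (0 : E) t = 0}.
Proof. exact: zeroE. Qed.

Definition Lp_dist (x y : E) : R :=
  fine (Lp_integral p (fun t => Lp_repr x t - Lp_repr y t)).

Let Lp_fnorm (x : E) : R := fine (Lp_integral p (Lp_repr x)).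

Let distE x y : Lp_dist x y = Lp_fnorm (x - y).
Proof.
rewrite /Lp_dist /Lp_fnorm; congr fine; apply: Lp_integral_ae.
- rewrite (_ : (fun _ => _) = (fun t => Lp_repr x t + (-1) * Lp_repr y t)).
    apply: measurable_fun_complexD; first exact: (Lp_reprP x).1.
    exact/measurable_fun_complexZ/(Lp_reprP y).1.
  by apply/funext => t; rewrite mulN1r.
- exact: (Lp_reprP _).1.
- by apply: filterS (Lp_reprB x y) => t ->.
Qed.

Let fnormD x y : Lp_fnorm (x + y) <= Lp_fnorm x + Lp_fnorm y.
Proof.
rewrite /Lp_fnorm -fineD ?Lp_integral_fin//; try exact: Lp_reprP.
rewrite fine_le ?Lp_integral_fin//; try exact: Lp_reprP.
  by rewrite fin_numD !Lp_integral_fin//; exact: Lp_reprP.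
rewrite (_ : Lp_integral p (Lp_repr (x + y)) =
  Lp_integral p (fun t => Lp_repr x t + Lp_repr y t)).
  by apply: Lp_integralD; exact: (Lp_reprP _).1.
apply: Lp_integral_ae; [exact: (Lp_reprP _).1| |exact: Lp_reprD].
by apply: measurable_fun_complexD; exact: (Lp_reprP _).1.
Qed.

Let fnormZ a x : Lp_fnorm (a *: x) = Normc.normc a `^ p * Lp_fnorm x.
Proof.
rewrite /Lp_fnorm (_ : Lp_integral p (Lp_repr (a *: x)) =
  Lp_integral p (fun t => a * Lp_repr x t)).
  rewrite Lp_integralZ; last exact: (Lp_reprP _).1.
  by rewrite fineM// Lp_integral_fin//; exact: Lp_reprP.
apply: Lp_integral_ae; [exact: (Lp_reprP _).1| |exact: Lp_reprZ].
exact/measurable_fun_complexZ/(Lp_reprP _).1.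
Qed.

Let fnorm_ge0 x : 0 <= Lp_fnorm x.
Proof. by rewrite fine_ge0// Lp_integral_ge0. Qed.

Let fnormN x : Lp_fnorm (- x) = Lp_fnorm x.
Proof.
by rewrite -scaleN1r fnormZ normcN Normc.normc1 powR1 mul1r.
Qed.

Let fnorm0 : Lp_fnorm 0 = 0.
Proof. by rewrite -(scale0r 0) fnormZ Normc.normc0 powR0 ?mul0r// gt_eqF. Qed.

Let fnorm_eq0 x : Lp_fnorm x = 0 -> x = 0.
Proof.
move=> x0.
have mf := (Lp_reprP x).1.
have i0 : (\int[mu]_t `|(Normc.normc (Lp_repr x t) `^ p)%:E| = 0)%E.
  under eq_integral do rewrite gee0_abs ?lee_fin ?powR_ge0//.
  have := Lp_integral_fin (Lp_reprP x).
  by rewrite -[LHS]/(Lp_integral p (Lp_repr x)) => /fineK <-; rewrite -[fine _]/(Lp_fnorm x) x0.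
have /(ae_eq_integral_abs _ measurableT (measurable_Lp_integrand mf)) := i0.
move=> ae0; apply/Lp_eqP.
apply: (filter_app _ _ (Lp_repr0)).
apply: (filter_app _ _ (ae0)).
apply: aeW.
move=> t /(_ I) [] /eqP; rewrite powR_eq0 => /andP[/eqP n0 _] ->.
exact: Normc.eq0_normc.
Qed.

Let distxx x : Lp_dist x x = 0.
Proof. by rewrite distE subrr fnorm0. Qed.

Let dist_positivity x y : Lp_dist x y = 0 -> x = y.
Proof. by rewrite distE => /fnorm_eq0/eqP; rewrite subr_eq0 => /eqP. Qed.

Let dist_sym x y : Lp_dist x y = Lp_dist y x.
Proof. by rewrite !distE -fnormN opprB. Qed.

Let dist_triangle y x z : Lp_dist x z <= Lp_dist x y + Lp_dist y z.
Proof.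
rewrite !distE (le_trans _ (fnormD _ _))//.
by rewrite addrA subrK.
Qed.

HB.instance Definition _ :=
  isMetric.Build R E distxx dist_positivity dist_sym dist_triangle.

Let Lp_ballE (x : E) (e : R) : ball x e = [set y | Lp_fnorm (y - x) < e].
Proof.
rewrite ballEmdist; apply/funext => y /=.
by rewrite -[mdist x y]/(Lp_dist x y) dist_sym distE.
Qed.

Let add_continuous : continuous (fun x : E * E => x.1 + x.2).
Proof.
move=> [x y]; apply/cvg_ballP => e e0.
have e2 : 0 < e / 2 by rewrite divr_gt0.
exists (ball x (e / 2), ball y (e / 2)); first by split; exact: nbhsx_ballx.
move=> [x' y'] [/= bx by']; move: bx by'; rewrite !Lp_ballE /= => bx by'.
rewrite opprD addrACA (le_lt_trans (fnormD _ _))//.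
by rewrite (splitr e) ltrD.
Qed.

Let scale_continuous : continuous (fun z : R[i]^o * E => z.1 *: z.2).
Proof.
move=> [a x]; apply/cvg_ballP => e e0.
have e2 : 0 < e / 2 by rewrite divr_gt0.
pose M := (Normc.normc a + 1) `^ p.
have M0 : 0 < M by rewrite powR_gt0// ltr_wpDl// normc_ge0.
pose c := e / 2 / (Lp_fnorm x + 1).
have N1 : 0 < Lp_fnorm x + 1 by rewrite ltr_wpDl.
have c0 : 0 < c by rewrite divr_gt0.
pose r := Num.min 1 (c `^ p^-1).
have r0 : 0 < r by rewrite lt_min ltr01 powR_gt0.
exists (ball (a : R[i]^o) (r%:C), ball x (e / 2 / M)).
  split; first by apply: nbhsx_ballx; rewrite ltcR.
  by apply: nbhsx_ballx; rewrite divr_gt0.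
move=> [b y] [/= ab xy]; move: xy; rewrite !Lp_ballE /= => xy.
have {}ab : Normc.normc (b - a) < r.
  move: ab; rewrite /ball /= distrC normc_def ltcR.
  by rewrite normcE_ReIm.
have -> : b *: y - a *: x = b *: (y - x) + (b - a) *: x.
  by rewrite scalerBr scalerBl addrA subrK.
rewrite (le_lt_trans (fnormD _ _))// !fnormZ (splitr e) ltr_leD//.
- have bM : Normc.normc b `^ p <= M.
    rewrite ge0_ler_powR ?nnegrE ?addr_ge0 ?normc_ge0 ?(ltW p0)//.
    rewrite -{1}(subrK a b) addrC (le_trans (le_normcD _ _))// lerD2l.
    by rewrite (le_trans (ltW ab))// ge_min lexx.
  rewrite (le_lt_trans (ler_wpM2r (fnorm_ge0 _) bM))//.
  by rewrite mulrC -ltr_pdivlMr.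
- have abc : Normc.normc (b - a) `^ p <= c.
    have -> : c = (c `^ p^-1) `^ p.
      by rewrite -powRrM mulVf ?gt_eqF// powRr1// ltW.
    rewrite ge0_ler_powR ?nnegrE ?powR_ge0 ?normc_ge0 ?(ltW p0)//.
    by rewrite (le_trans (ltW ab))// ge_min lexx orbT.
  rewrite (le_trans (ler_wpM2r (fnorm_ge0 _) abc))//.
  by rewrite /c mulrAC ler_pdivrMr// ler_pM2l// lerDl.
Qed.

HB.instance Definition _ :=
  PreTopologicalNmodule_isTopologicalNmodule.Build E add_continuous.
HB.instance Definition _ :=
  TopologicalNmodule_isTopologicalLmodule.Build R[i] E scale_continuous.

Lemma Lp_hausdorff : hausdorff_space E.
Proof. exact: metric_hausdorff. Qed.

End LpOperations.
End LpSpace.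

Section LpIndicator.
Context d (T : measurableType d) (R : realType).
Variables (mu : {finite_measure set T -> \bar R}) (p : R) (hp : 0 < p < 1).

Lemma in_Lp_indic (A : set T) : measurable A ->
  in_Lp mu p (fun t => (\1_A t : R)%:C).
Proof.
move=> mA; split.
  apply/measurable_fun_complexP; split => /=; last exact: measurable_cst.
  exact: measurable_indic.
rewrite /Lp_integral (_ : (fun _ => _) = (fun t => (\1_A t)%:E)).
  rewrite integral_indic// setIT.
  by rewrite ltey_eq fin_num_measure.
apply/funext => t; rewrite indicE; case: (t \in A) => /=.
  by rewrite expr1n expr0n addr0 sqrtr1 powR1.
by rewrite expr0n addr0 sqrtr0 powR0// gt_eqF//; case/andP: hp.
Qed.

Definition Lp_indic (A : set T) (mA : measurable A) : Lp mu hp :=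
  Lp_class hp (in_Lp_indic mA).

End LpIndicator.

Section HalfPlane.
Context {R : realType}.

Definition halfplane (z : R[i]) : set R[i] :=
  [set w | complex.Re w <= complex.Re z].

Lemma measurable_halfplane (z : R[i]) : measurable (halfplane z).
Proof.
have -> : halfplane z = @complex.Re R @^-1` `]-oo, complex.Re z].
  by apply/seteqP; split => w /=; rewrite in_itv.
rewrite -[X in measurable X]setTI; apply: measurable_Re => //.
Qed.

Lemma half_lt_unit (p : R) : 2^-1 < p < 1 -> 0 < p < 1.
Proof. by case/andP => hp ->; rewrite (lt_trans _ hp)// invr_gt0. Qed.

End HalfPlane.

(* Main.v *)
(* The L^p "norm" is p-homogeneous, and f z - f w is the indicator of a strip
   whose Gauss measure is at most |Re (z - w)|. The difference quotient of f at
   (z, w) therefore has size at most |z - w|^(1-p), which tends to 0 since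
   p < 1. This gives C^1, and moving along an imaginary direction, where f is
   constant, shows that the derivative is 0. For C^2, f^{<2>}(t, 0, 0) would be
   t^-2 (f t - f 0), of size at least a constant times t^(1-2p), which is
   unbounded as t tends to 0 because p > 1/2. *)
Require Import Defs.
From mathcomp Require Import all_boot all_order all_algebra.
From mathcomp Require Import complex.
From mathcomp Require Import all_classical all_reals all_analysis.
From mathcomp Require Import measurable_realfun.
From mathcomp Require Import ring.

Import Order.TTheory GRing.Theory Num.Theory.
Import numFieldNormedType.Exports.

Local Open Scope classical_set_scope.
Local Open Scope complex_scope.
Local Open Scope ring_scope.

Set Implicit Arguments.
Unset Strict Implicit.
Unset Printing Implicit Defensive.

(** * The metric of L^p and its homogeneity *)

Section LpMetric.
Context d (T : measurableType d) (R : realType).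
Variables (mu : {measure set T -> \bar R}) (p : R) (hp : 0 < p < 1).
Local Notation E := (Lp mu hp).

Lemma measurable_Lp_repr (x : E) : measurable_fun setT (Lp_repr x).
Proof. exact: (Lp_reprP x).1. Qed.

Lemma measurable_fun_complexB (f g : T -> R[i]) :
  measurable_fun setT f -> measurable_fun setT g ->
  measurable_fun setT (fun t => f t - g t).
Proof.
move=> mf mg; under eq_fun do rewrite -mulN1r.
exact/measurable_fun_complexD/measurable_fun_complexZ.
Qed.

(** Representatives of classes are opaque choices; this allows a distance to be computed from any
    convenient measurable function in the class of the difference. *)
Lemma Lp_distE (x y : E) f : measurable_fun setT f ->
  {ae mu, forall t, Lp_repr x t - Lp_repr y t = f t} ->
  mdist x y = fine (Lp_integral mu p f).
Proof.
move=> mf xyf; rewrite -[mdist x y]/(Lp_dist x y); congr fine.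
apply: Lp_integral_ae => //.
by apply: measurable_fun_complexB; exact: measurable_Lp_repr.
Qed.

Lemma Lp_dist0E (x : E) : mdist x 0 = fine (Lp_integral mu p (Lp_repr x)).
Proof.
apply: Lp_distE; first exact: measurable_Lp_repr.
by apply: filterS (Lp_repr0 mu hp) => t ->; rewrite subr0.
Qed.

Lemma Lp_distB0 (x y : E) : mdist (x - y) 0 = mdist x y.
Proof.
rewrite Lp_dist0E; apply/esym/Lp_distE; first exact: measurable_Lp_repr.
by apply: filterS (Lp_reprB x y) => t ->.
Qed.

Lemma Lp_distZ0 (a : R[i]) (x : E) :
  mdist (a *: x) 0 = Normc.normc a `^ p * mdist x 0.
Proof.
have mx := measurable_Lp_repr x.
rewrite (@Lp_distE _ _ (fun t => a * Lp_repr x t)).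
- rewrite Lp_integralZ// Lp_dist0E fineM// Lp_integral_fin//; exact: Lp_reprP.
- exact: measurable_fun_complexZ.
- apply: filterS2 (Lp_repr0 mu hp) (Lp_reprZ a x) => t -> ->.
  by rewrite subr0.
Qed.

End LpMetric.

(** * Distances between indicator functions *)

Section LpIndicatorDist.
Context d (T : measurableType d) (R : realType).
Variables (mu : {finite_measure set T -> \bar R}) (p : R) (hp : 0 < p < 1).

(** The p-th power fixes 1, and it fixes 0 because p > 0, so the integrand is the indicator
    itself. *)
Lemma Lp_integral_indic (A : set T) : measurable A ->
  Lp_integral mu p (fun t => (\1_A t : R)%:C) = mu A.
Proof.
move=> mA; rewrite /Lp_integral -[A in RHS]setIT -integral_indic//.
apply: eq_integral => t _; congr EFin.
rewrite normcE_ReIm /= expr0n addr0 sqrtr_sqr indicE; case: (t \in A) => /=.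
  by rewrite normr1 powR1.
by rewrite normr0 powR0// gt_eqF//; case/andP: hp.
Qed.

Lemma Lp_dist_indic (A B : set T) (mA : measurable A) (mB : measurable B) :
  A `<=` B -> mdist (Lp_indic mu hp mB) (Lp_indic mu hp mA) =
    fine (mu (B `\` A)).
Proof.
move=> AB; rewrite -(Lp_integral_indic (measurableD mB mA)).
apply: Lp_distE.
  by case: (in_Lp_indic mu hp (measurableD mB mA)).
apply: filterS2 (Lp_repr_class hp (in_Lp_indic mu hp mA))
  (Lp_repr_class hp (in_Lp_indic mu hp mB)) => t At Bt.
rewrite [Lp_repr _ t]Bt [X in _ - X]At -rmorphB /=; congr (_%:C).
rewrite setDE indicI indicC /= !indicE.
have [/set_mem/AB/mem_set ->|] := boolP (t \in A); first by rewrite subrr mulr0.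
by rewrite subr0 mulr1.
Qed.

End LpIndicatorDist.

(** * Gauss measure of vertical strips *)

Section GaussStrip.
Context {R : realType}.
Local Notation gdens := (fun x : R => expR (- x ^+ 2) / Num.sqrt pi).

(** The preimage is the cylinder A x R, and the second factor has mass 1. *)
Lemma gauss_Re_preimage (A : set R) : measurable A ->
  gauss (@complex.Re R @^-1` A) = gauss1 A.
Proof.
move=> mA; rewrite /gauss /pushforward.
have -> : complex_of_pair @^-1` (@complex.Re R @^-1` A) = A `*` setT.
  by apply/seteqP; split => -[x y] //= [].
by rewrite product_measure1E// [X in (_ * X)%E]probability_setT mule1.
Qed.

Let measurable_gdens (D : set R) : measurable_fun D (fun x => (gdens x)%:E).
Proof.
apply/measurable_EFinP; apply: measurable_funTS.
apply: continuous_measurable_fun => x.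
apply: cvgM; last exact: cvg_cst.
apply: (@continuous_comp _ _ _ (fun x : R => - x ^+ 2)); last exact: continuous_expR.
by apply: cvgN; exact: exprn_continuous.
Qed.

Let sqrtpi_ge1 : 1 <= Num.sqrt (pi : R).
Proof.
by rewrite -sqrtr1 ler_wsqrtr// (le_trans _ (pi_ge2 R))// ler1n.
Qed.

Let integral_cst_itvoc (k a b : R) : a <= b ->
  (\int[lebesgue_measure]_(x in `]a, b]) k%:E = (k * (b - a))%:E)%E.
Proof.
move=> ab; rewrite integral_cst// EFinM; congr (_ * _)%E.
rewrite [LHS](lebesgue_measure_itv `]a, b])/= lte_fin.
by move: ab; rewrite le_eqVlt => /predU1P[->|->]; rewrite ?ltxx ?subrr.
Qed.

(** The density is at most 1, since exp(-x^2) <= 1 <= sqrt(pi). *)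
Lemma gauss1_itv_le (a b : R) : a <= b -> (gauss1 `]a, b] <= (b - a)%:E)%E.
Proof.
move=> ab; rewrite -[b - a]mul1r -integral_cst_itvoc//.
apply: ge0_le_integral => //.
  exact: measurable_gdens.
move=> x _; rewrite lee_fin ler_pdivrMr ?(lt_le_trans ltr01)// mul1r.
by rewrite (le_trans _ sqrtpi_ge1)// -expR0 ler_expR oppr_le0 sqr_ge0.
Qed.

(** For 0 < x <= t <= 1 one has x^2 <= 1, so the density is at least exp(-1) / sqrt(pi). *)
Lemma gauss1_itv_ge (t : R) : 0 <= t <= 1 ->
  (((expR (- 1) / Num.sqrt pi * t)%:E)%R <= gauss1 `]0%R, t])%E.
Proof.
move=> /andP[t0 t1]; rewrite -[t in leLHS]subr0 -integral_cst_itvoc//.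
apply: ge0_le_integral => //.
  exact: measurable_gdens.
move=> x /=; rewrite in_itv/= => /andP[x0 xt]; rewrite lee_fin.
rewrite ler_pM2r ?invr_gt0 ?(lt_le_trans ltr01)// ler_expR lerN2.
by rewrite exprn_ile1// ?(ltW x0)// (le_trans xt).
Qed.

End GaussStrip.

(** * Distances between half-plane indicators *)

Section HalfPlaneDist.
Context (R : realType) (p : R) (hp : 0 < p < 1).
Local Notation E := (Lp (@gauss R) hp).

(** The map f of the theorem, for every p with 0 < p < 1; the bound p > 1/2 enters in
    [halfplane_not_C2]. *)
Definition halfplane_class (z : R[i]) : E :=
  Lp_indic gauss hp (measurable_halfplane z).
Local Notation f := halfplane_class.

Lemma halfplane_distE (z w : R[i]) : complex.Re z <= complex.Re w ->
  mdist (f w) (f z) = fine (gauss1 `]complex.Re z, complex.Re w]).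
Proof.
move=> zw; rewrite Lp_dist_indic; last by move=> u /= /le_trans; exact.
rewrite -(gauss_Re_preimage (measurable_itv `]complex.Re z, complex.Re w])).
congr (fine (gauss _)); apply/seteqP; split=> u /=; rewrite in_itv/= ltNge.
  by move=> [uw /negP uz]; apply/andP.
by move=> /andP[/negP].
Qed.

Lemma halfplane_dist_le (z w : R[i]) :
  mdist (f z) (f w) <= `|complex.Re z - complex.Re w|.
Proof.
wlog zw : z w / complex.Re w <= complex.Re z.
  move=> H; have [|/ltW] := leP (complex.Re w) (complex.Re z); first exact: H.
  by rewrite metric_sym distrC; exact: H.
rewrite halfplane_distE// ger0_norm ?subr_ge0// -lee_fin fineK ?fin_num_measure//.
exact: gauss1_itv_le.
Qed.

Lemma halfplane_dist_ge (t : R) : 0 <= t <= 1 ->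
  expR (- 1) / Num.sqrt pi * t <= mdist (f t%:C) (f 0).
Proof.
move=> t01; rewrite halfplane_distE/=; last by case/andP: t01.
by rewrite -lee_fin fineK ?fin_num_measure//; exact: gauss1_itv_ge.
Qed.

End HalfPlaneDist.

(** * First divided differences on the whole field *)

Section DividedDifference.
Context {K : numFieldType} {E : topologicalLmodType K}.

Lemma continuous_within_pow_setT n (g : 'rV[K^o]_n -> E) :
  {within pow_set setT n, continuous g} <-> continuous g.
Proof.
have -> : pow_set (setT : set K) n = setT by apply/seteqP; split.
split=> [|cg]; last exact: continuous_subspaceT.
rewrite continuous_open_subspace; last exact: openT.
by move=> cg x; apply: cg; rewrite inE.
Qed.

(** Since the inverse of 0 is 0, this takes the value 0 on the diagonal. That is the right extension
    for a map with zero derivative, so it can serve as f^{<1>} without a case distinction. *)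
Definition diff_quotient (f : K -> E) (x : 'rV[K^o]_2) : E :=
  (x ord0 0 - x ord0 1)^-1 *: (f (x ord0 0) - f (x ord0 1)).

Let col'1 (x : 'rV[K^o]_2) : (col' 1 x) ord0 ord0 = x ord0 0.
Proof. by rewrite mxE; congr (x _ _); exact: val_inj. Qed.

Let col'0 (x : 'rV[K^o]_2) : (col' 0 x) ord0 ord0 = x ord0 1.
Proof. by rewrite mxE; congr (x _ _); exact: val_inj. Qed.

Lemma divided_difference1_diff_quotient (f : K -> E) :
  continuous (f : K^o -> E) -> continuous (diff_quotient f) ->
  divided_difference setT f 1 (diff_quotient f).
Proof.
move=> cf cq; split; first exact/continuous_within_pow_setT.
exists (fun x => f (x ord0 ord0)); last first.
  by move=> x _ _; rewrite col'1 col'0.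
split=> //; apply/continuous_within_pow_setT => x.
apply: (@continuous_comp _ _ _ (fun x : 'rV[K^o]_1 => x ord0 ord0) f).
  exact: coord_continuous.
exact: cf.
Qed.

Lemma divided_difference1E (f : K -> E) g : divided_difference setT f 1 g ->
  continuous g /\ forall x : 'rV[K^o]_2, x ord0 0 != x ord0 1 -> g x = diff_quotient f x.
Proof.
move=> [/continuous_within_pow_setT cg [h [_ hf] gh]]; split=> // x x01.
by rewrite gh// !hf// col'1 col'0.
Qed.

Lemma continuous_diff_quotient_offdiag (f : K -> E) (x : 'rV[K^o]_2) :
  continuous (f : K^o -> E) -> x ord0 0 != x ord0 1 ->
  {for x, continuous (diff_quotient f)}.
Proof.
move=> cf x01; have cx i : (fun y : 'rV[K^o]_2 => y ord0 i) @ x --> (x ord0 i : K^o).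
  exact: coord_continuous.
have cfx i : (fun y : 'rV[K^o]_2 => f (y ord0 i)) @ x --> f (x ord0 i).
  apply: (@continuous_comp _ _ _ (fun y : 'rV[K^o]_2 => y ord0 i) f).
    exact: cx.
  exact: cf.
apply: (@continuous2_cvg _ K^o E E (nbhs x) _
  (fun y => (y ord0 0 - y ord0 1)^-1) (fun y => f (y ord0 0) - f (y ord0 1))
  (fun a v => a *: v)).
- exact: (@scale_continuous K E (_, _)).
- apply: cvgV; first by rewrite subr_eq0.
  exact: cvgB.
- apply: (@continuous2_cvg _ E E E (nbhs x) _
    (fun y => f (y ord0 0)) (fun y => f (y ord0 1)) (fun v w => v - w)); last 2 first.
  + exact: cfx.
  + exact: cfx.
  exact: (@sub_continuous E (_, _)).
Qed.

End DividedDifference.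

Lemma powRVK (R : realType) (x q : R) : 0 <= x -> q != 0 ->
  (x `^ q^-1) `^ q = x.
Proof. by move=> x0 q0; rewrite -powRrM mulVf// powRr1. Qed.

Lemma metric_continuousP (R : realType) (T : topologicalType) (M : metricType R)
    (g : T -> M) :
  continuous g <->
  forall x e, 0 < e -> \forall y \near x, mdist (g x) (g y) < e.
Proof.
split=> cg x; first exact/metricType_numDomainType.cvgrPdist_lt/cg.
by apply/metricType_numDomainType.cvgrPdist_lt => e; exact: cg.
Qed.

(** * Differentiability of the half-plane map *)

Section HalfPlaneDifferentiability.
Context (R : realType) (p : R) (hp : 0 < p < 1).
Local Notation C := (R[i]^o).
Local Notation f := (@halfplane_class R p hp).

Let p1 : p < 1. Proof. by case/andP: hp. Qed.

Lemma normr_normc (z : R[i]) : `|z| = (Normc.normc z)%:C.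
Proof. by rewrite normc_def normcE_ReIm. Qed.

Lemma normc_real (t : R) : 0 <= t -> Normc.normc t%:C = t.
Proof. by move=> t0; rewrite /= expr0n addr0 sqrtr_sqr ger0_norm. Qed.

Lemma real_complex_neq0 (t : R) : 0 < t -> t%:C != 0.
Proof. by move=> t0; rewrite eq_complex /= eqxx andbT gt_eqF. Qed.

Lemma norm_Re_le_normc (z : R[i]) : `|complex.Re z| <= Normc.normc z.
Proof. by rewrite normcE_ReIm -sqrtr_sqr ler_wsqrtr// lerDl sqr_ge0. Qed.

Lemma halfplane_dist_le_normc (z w : R[i]) :
  mdist (f z) (f w) <= Normc.normc (z - w).
Proof.
apply: le_trans (norm_Re_le_normc _); apply: le_trans (halfplane_dist_le _ _ _) _.
by case: z w => [a b] [c d].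
Qed.

Lemma halfplane_class_continuous : continuous (f : C -> _).
Proof.
apply/metric_continuousP => z e e0.
have : \forall w \near (z : C), `|z - w| < e%:C.
  by apply: (@nbhsx_ballx _ C); rewrite ltcR.
apply: filterS => w; rewrite normr_normc ltcR.
exact/le_lt_trans/halfplane_dist_le_normc.
Qed.

Lemma diff_quotient_dist_le (x : 'rV[C]_2) :
  mdist (diff_quotient f x) 0 <= Normc.normc (x ord0 0 - x ord0 1) `^ (1 - p).
Proof.
rewrite Lp_distZ0 Lp_distB0 Normc.normcV.
set r := Normc.normc _; have r0 : 0 <= r by exact: normc_ge0.
apply: le_trans (ler_wpM2l (powR_ge0 _ _) (halfplane_dist_le_normc _ _)) _.
rewrite -/r -powR_inv1// -powRrM mulN1r.
(* Adding the exponents -p and 1 requires r to be nonzero; for r = 0 the left side vanishes through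
   its factor r. *)
have [->|rn0] := eqVneq r 0; first by rewrite mulr0 powR_ge0.
by rewrite -[X in _ * X](powRr1 r0) -powRD ?rn0 ?implybT// addrC.
Qed.

Lemma diff_quotient_halfplane_continuous : continuous (diff_quotient f).
Proof.
apply/metric_continuousP => x e e0.
have [x01|x01] := eqVneq (x ord0 0) (x ord0 1); last first.
  have := continuous_diff_quotient_offdiag halfplane_class_continuous x01.
  by move/metricType_numDomainType.cvgrPdist_lt; exact.
have -> : diff_quotient f x = 0 by rewrite /diff_quotient x01 !subrr scaler0.
have d0 : (fun y : 'rV[C]_2 => y ord0 0 - y ord0 1 : C) @ x --> (0 : C).
  have cx i : (fun y : 'rV[C]_2 => y ord0 i) @ x --> (x ord0 i : C).
    exact: coord_continuous.
  by rewrite -[0 : C](subrr (x ord0 1)) -{1}x01; exact: (cvgB (cx 0) (cx 1)).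
have q0 : 0 < 1 - p by rewrite subr_gt0.
(* This radius is the solution d of d^(1-p) = e, matching the bound of [diff_quotient_dist_le]. *)
have d1 : 0 < (e `^ (1 - p)^-1)%:C by rewrite ltcR powR_gt0.
have /(_ (nbhs_filter x)) := cvgr0_norm_lt _ d0 _ d1.
apply: filterS => y; rewrite normr_normc ltcR metric_sym => ye.
apply: le_lt_trans (diff_quotient_dist_le y) _.
rewrite -[ltRHS](powRVK (ltW e0) (lt0r_neq0 q0)).
by apply: gt0_ltr_powR; rewrite ?nnegrE ?normc_ge0 ?powR_ge0.
Qed.

(** Reduces a neighbourhood in several complex variables to one real parameter t > 0 moving the
    first coordinate in direction u. It is applied with u = i for the derivative and with u = 1
    against C^2. *)
Lemma near_row_shift n (x : 'rV[C]_n.+1) (u : R[i]) (P : set 'rV[C]_n.+1) :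
  Normc.normc u <= 1 -> nbhs x P ->
  \forall t \near (0 : R)^'+, P (x + (t%:C * u) *: delta_mx ord0 ord0).
Proof.
move=> u1 /nbhs_ballP[e e0 xeP].
have {}e0 : (0 : R[i]) < e by exact: e0.
(* The radius e lives in [R[i]], where being positive forces it to be real. *)
have /andP[/eqP eI eR] : (complex.Im e == 0) && (0 < complex.Re e).
  by move: (e0); rewrite ltcE.
have eE : e = (complex.Re e)%:C by case: e eI {e0 xeP eR} => a b /= ->.
near=> t; apply: xeP; split=> // i j; rewrite /ball/= !mxE.
have t0 : 0 < t by near: t; exact: nbhs_right_gt.
have te : t < complex.Re e by near: t; exact: nbhs_right_lt.
rewrite opprD addNKr normrN !normrM !normr_normc normc_real ?(ltW t0)//.
rewrite eE -!rmorphM ltcR; apply: le_lt_trans te.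
rewrite -mulrA ler_piMr ?(ltW t0)// mulr_ile1 ?normc_ge0//.
by case: (_ && _); rewrite ?Normc.normc0 ?Normc.normc1.
Unshelve. all: by end_near. Qed.

(** At (z + it, z) with t > 0 the two values of f agree, so g vanishes there, and these points tend
    to (z, z). Taking g arbitrary covers both the choice made by [bgn_derivative] and the unknown
    f^{<1>} inside the definition of C^2. *)
Lemma divided_difference1_halfplane_diag g (z : R[i]) :
  divided_difference setT f 1 g -> g (const_mx z) = 0.
Proof.
move=> /divided_difference1E[cg gE]; apply/eqP/negP => /negP g0.
have e0 : 0 < mdist (g (const_mx z)) 0 by rewrite mdist_gt0.
have /metric_continuousP/(_ (const_mx z) _ e0) := cg.
have i1 : Normc.normc ('i : R[i]) <= 1.
  by rewrite /= expr0n expr1n add0r sqrtr1.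
move=> /(near_row_shift i1) near_e.
(* The filter of right neighbourhoods of 0 is proper, so a contradiction for all small t > 0
   suffices. *)
have : \forall t \near (0 : R)^'+, False; last by move=> /filter_ex[].
near=> t; have t0 : 0 < t by near: t; exact: nbhs_right_gt.
pose y : 'rV[C]_2 := const_mx z + (t%:C * 'i) *: delta_mx ord0 ord0.
have : mdist (g (const_mx z)) (g y) < mdist (g (const_mx z)) 0.
  by rewrite /y; near: t; exact: near_e.
have y1 : y ord0 1 = z by rewrite !mxE mulr0 addr0.
have y0 : y ord0 0 = z + t%:C * 'i by rewrite !mxE mulr1.
have gy : g y = 0.
  rewrite gE; last first.
    rewrite y0 y1 -subr_eq0 addrC addKr mulf_neq0//.
      exact: real_complex_neq0.
    by rewrite eq_complex /= oner_eq0 andbF.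
  rewrite /diff_quotient y0 y1; apply/eqP; rewrite scaler_eq0; apply/orP; right.
  rewrite subr_eq0; apply/eqP/mdist_positivity/le_anti; rewrite mdist_ge0 andbT.
  rewrite (le_trans (halfplane_dist_le _ _ _))//.
  by case: (z) => a b /=; rewrite mulr0 mul0r subrr addr0 subrr normr0.
by rewrite gy ltxx.
Unshelve. all: by end_near. Qed.

Lemma halfplane_not_C2 : 2^-1 < p -> ~ of_class 2 setT f.
Proof.
move=> hp2 [g [/continuous_within_pow_setT cg [h hd gE]]].
have [_ hE] := divided_difference1E hd.
have h00 := divided_difference1_halfplane_diag 0 hd.
pose m := expR (- 1) / Num.sqrt pi : R.
have m0 : 0 < m by rewrite divr_gt0 ?expR_gt0// sqrtr_gt0 pi_gt0.
(* By continuity at 0 and the triangle inequality, M strictly bounds the distance from g to 0 near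
   the origin. *)
pose M := 1 + mdist (g 0) 0.
have M0 : 0 < M by rewrite ltr_pwDl// mdist_ge0.
have q0 : 0 < 2 * p - 1 by rewrite subr_gt0 mulrC -ltr_pdivrMr// div1r.
(* Chosen so that c^(2p-1) = m / M; as 2p - 1 > 0, every t < c satisfies t^(2p-1) M < m. *)
pose c := (m / M) `^ (2 * p - 1)^-1.
have c0 : 0 < c by rewrite powR_gt0// divr_gt0.
have /metric_continuousP/(_ 0 _ ltr01) := cg.
have u1 : Normc.normc (1 : R[i]) <= 1 by rewrite Normc.normc1.
move=> /(near_row_shift u1) near0.
have : \forall t \near (0:R)^'+, False.
  near=> t; have t0 : 0 < t by near: t; exact: nbhs_right_gt.
  have t1 : t < 1 by near: t; exact: nbhs_right_lt.
  have tc : t < c by near: t; exact: nbhs_right_lt.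
  (* The point (t, 0, 0). Removing coordinate 0 gives (0, 0), where h vanishes; removing coordinate
     1 gives (t, 0), where h is the difference quotient of f. *)
  pose y : 'rV[C]_3 := 0 + (t%:C * 1) *: delta_mx ord0 ord0.
  have gy : mdist (g 0) (g y) < 1 by rewrite /y; near: t; exact: near0.
  have y0 : y ord0 0 = t%:C by rewrite !mxE !mulr1 add0r.
  have y1 : y ord0 1 = 0 by rewrite !mxE mulr0 add0r.
  have tn : t%:C != 0 :> R[i] by rewrite real_complex_neq0.
  have : mdist (g y) 0 < M.
    by rewrite (le_lt_trans (metric_triangle _ (g 0) _))// ltrD2r metric_sym.
  have c1 : col' 0 y = const_mx 0.
    by apply/matrixP => i j; rewrite !mxE /= andbF mulr0 add0r.
  have c0y : (col' 1 y) ord0 0 = t%:C by rewrite !mxE !mulr1 add0r.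
  have c1y : (col' 1 y) ord0 1 = 0 by rewrite !mxE mulr0 add0r.
  rewrite gE//; last by rewrite y0 y1.
  rewrite y0 y1 c1 h00 !subr0 hE; last by rewrite c0y c1y.
  rewrite /diff_quotient c0y c1y subr0 !Lp_distZ0 Lp_distB0.
  rewrite Normc.normcV normc_real ?(ltW t0)//.
  apply/negP; rewrite -leNgt.
  have mt : m * t <= mdist (f t%:C) (f 0).
    by apply: halfplane_dist_ge; rewrite !ltW.
  have tp : 0 < t^-1 `^ p by rewrite powR_gt0 ?invr_gt0.
  (* Each of the two divisions by t contributes a factor t^(-p), so it remains to compare M with m
     t^(1-2p). *)
  apply: le_trans (ler_wpM2l (ltW tp) (ler_wpM2l (ltW tp) mt)).
  have tMm : t `^ (2 * p - 1) * M < m.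
    rewrite -ltr_pdivlMr// -[ltRHS](powRVK (ltW (divr_gt0 m0 M0)) (lt0r_neq0 q0)).
    by apply: gt0_ltr_powR; rewrite ?nnegrE ?powR_ge0 ?(ltW t0).
  have tpE : t^-1 `^ p * (t^-1 `^ p * t) = (t `^ (2 * p - 1))^-1.
    rewrite -(powR_inv1 (ltW t0)) -powRrM mulN1r -[X in _ * (_ * X)](powRr1 (ltW t0)).
    have td : forall r s : R, t `^ r * t `^ s = t `^ (r + s).
      by move=> r s; rewrite powRD// (gt_eqF t0) implybT.
    by rewrite !td -powRN opprB; congr (t `^ _); ring.
  rewrite [m * t]mulrC mulrA mulrA -[_ * _ * t]mulrA tpE mulrC.
  by rewrite ler_pdivlMr ?powR_gt0// mulrC ltW.
by move=> /filter_ex[].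
Unshelve. all: by end_near. Qed.

End HalfPlaneDifferentiability.

Theorem proposition3 (R : realType) (p : R) (hp : 2^-1 < p < 1) :
  let E := Lp (@gauss R) (half_lt_unit hp) in
  let f : R[i] -> E :=
    fun z => Lp_indic gauss (half_lt_unit hp) (measurable_halfplane z) in
  [/\ of_class 1 setT f,
      (forall z : R[i], bgn_derivative setT f z = 0)
    & ~ of_class 2 setT f].
Proof.
move=> E f.
have f1 : divided_difference setT f 1 (diff_quotient f).
  apply: divided_difference1_diff_quotient.
    exact: halfplane_class_continuous.
  exact: diff_quotient_halfplane_continuous.
split.
- by exists (diff_quotient f).
- move=> z; apply: (@divided_difference1_halfplane_diag R p (half_lt_unit hp)).
  (* As a divided difference exists, [xget] returns a genuine one and not its default. *)
  by apply: xgetPex; exists (diff_quotient f).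
- by have /andP[hp2 _] := hp; exact: halfplane_not_C2.
Qed.
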